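(* Consider a federated learning system with $n$ clients, of which clients $1,\dots,m$ ($0\le m<n$) are malicious. All malicious clients are detected and removed, so that clients $m+1,\dots,n$ remain. Let $\mathcal{L}_i:\mathbb{R}^d\to\mathbb{R}$ be the (differentiable) loss function of client $i$. Suppose the following hold. (1) There are constants $\mu>0$ and $L>0$ such that for each client $i$ and all $\bm{w},\bm{w}'\in\mathbb{R}^d$, $$\langle\bm{w}-\bm{w}',\nabla\mathcal{L}_i(\bm{w})-\nabla\mathcal{L}_i(\bm{w}')\rangle\ge\mu\Vert\bm{w}-\bm{w}'\Vert^2,$$ $$\langle\bm{w}-\bm{w}',\nabla\mathcal{L}_i(\bm{w})-\nabla\mathcal{L}_i(\bm{w}')\rangle\ge\frac1L\Vert\nabla\mathcal{L}_i(\bm{w})-\nabla\mathcal{L}_i(\bm{w}')\Vert^2.$$ (2) The L-BFGS algorithm computes the integrated Hessian-vector products exactly, i.e. every approximated Hessian-vector product $\tilde{\bm{H}}_t^i(\hat{\bm{w}}_t-\bar{\bm{w}}_t)$ computed during FedRecover (client $i$, round $t$) satisfies $$\tilde{\bm{H}}_t^i(\hat{\bm{w}}_t-\bar{\bm{w}}_t)+\bar{\bm{g}}_t^i=\bm{g}_t^i,\qquad \bm{g}_t^i=\nabla\mathcal{L}_i(\hat{\bm{w}}_t).$$ (3) FedAvg is used as the aggregation rule, the abnormality threshold is $\tau=\infty$ (abnormality fixing is not used), and the learning rate $\eta>0$ satisfies $\eta\le\min(\frac1\mu,\frac1L)$. Let $\hat{\bm{w}}_t$ and $\bm{w}_t$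 be the global models recovered in round $t$ by FedRecover and by train-from-scratch, respectively. Then for each round $t>0$, $$\Vert\hat{\bm{w}}_t-\bm{w}_t\Vert\le(\sqrt{1-\eta\mu})^t\,\Vert\hat{\bm{w}}_0-\bm{w}_0\Vert.$$ Therefore, the global model recovered by FedRecover converges to the global model recovered by train-from-scratch: when the two procedures are run for infinitely many rounds, $\lim_{t\to\infty}\hat{\bm{w}}_t=\lim_{t\to\infty}\bm{w}_t$.
   Context: $\Vert\cdot\Vert$ is the $\ell_2$ norm and $\langle\cdot,\cdot\rangle$ the inner product on $\mathbb{R}^d$. Setup. Client $i$ has a finite nonempty local dataset $D_i$. Let $D'=\bigcup_{i=m+1}^n D_i$ be the joint dataset of the remaining clients, with $|D'|=\sum_{i=m+1}^n|D_i|$. FedAvg over the remaining clients aggregates vectors $\bm{x}^{m+1},\dots,\bm{x}^n$ into $\sum_{i=m+1}^n\frac{|D_i|}{|D'|}\bm{x}^i$. Historical information. The server has stored, from the original (poisoned) training, the original global models $\bar{\bm{w}}_t\in\mathbb{R}^d$ and the original model updates $\bar{\bm{g}}_t^i\in\mathbb{R}^d$; for a benign client, $\bar{\bm{g}}_t^i=\nabla\mathcal{L}_i(\bar{\bm{w}}_t)$. The original global models may have been influenced arbitrarily by the malicious clients. Train-from-scratch. From an initial model $\bm{w}_0$, $$\bm{w}_{t+1}=\bm{w}_t-\eta\sum_{i=m+1}^n\frac{|D_i|}{|D'|}\nabla\mathcal{L}_i(\bm{w}_t).$$ FedRecover with FedAvg and $\tau=\infty$. Parameters: total number of rounds $T$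 (for the limit $t\to\infty$ one takes $T=\infty$, in which case there are no final tuning rounds), number of warm-up rounds $T_w$, correction period $T_c$, number of final tuning rounds $T_f$, and L-BFGS buffer size $s<T_w$. Start from $\hat{\bm{w}}_0=\bar{\bm{w}}_0$. For each round $0\le t<T$: - Exact rounds: if $t<T_w$, or $(t-T_w+1)\bmod T_c=0$, or $t\ge T-T_f$, then $$\hat{\bm{w}}_{t+1}=\hat{\bm{w}}_t-\eta\sum_{i=m+1}^n\frac{|D_i|}{|D'|}\bm{g}_t^i,\qquad \bm{g}_t^i=\nabla\mathcal{L}_i(\hat{\bm{w}}_t).$$ - Estimated rounds: otherwise, $$\hat{\bm{w}}_{t+1}=\hat{\bm{w}}_t-\eta\sum_{i=m+1}^n\frac{|D_i|}{|D'|}\big[\tilde{\bm{H}}_t^i(\hat{\bm{w}}_t-\bar{\bm{w}}_t)+\bar{\bm{g}}_t^i\big].$$ L-BFGS. In an estimated round $t$, the vector $\tilde{\bm{H}}_t^i(\hat{\bm{w}}_t-\bar{\bm{w}}_t)\in\mathbb{R}^d$ is the output of the following procedure with $\bm{v}=\hat{\bm{w}}_t-\bar{\bm{w}}_t$. Let $b_1<\dots<b_s$ be the $s$ most recent exact rounds before $t$, and put $\Delta\bm{w}_b=\hat{\bm{w}}_b-\bar{\bm{w}}_b$, $\Delta\bm{g}_b^i=\bm{g}_b^i-\bar{\bm{g}}_b^i$, $\Delta\bm{W}=[\Delta\bm{w}_{b_1},\dots,\Delta\bm{w}_{b_s}]$, $\Delta\bm{G}=[\Delta\bm{g}_{b_1}^i,\dots,\Delta\bm{g}_{b_s}^i]$.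 Let $\bm{A}=\Delta\bm{W}^T\Delta\bm{G}$, let $\bm{D}$ be the diagonal matrix of $\bm{A}$, let $\bm{L}$ be the lower triangular matrix of $\bm{A}$ (unrelated to the constant $L$), and let $\sigma=\big((\Delta\bm{g}_{b_{s-1}}^i)^T\Delta\bm{w}_{b_{s-1}}\big)/\big(\Delta\bm{w}_{b_{s-1}}^T\Delta\bm{w}_{b_{s-1}}\big)$. Set $$\bm{p}=\begin{bmatrix}-\bm{D}&\bm{L}^T\\ \bm{L}&\sigma\Delta\bm{W}^T\Delta\bm{W}\end{bmatrix}^{-1}\begin{bmatrix}\Delta\bm{G}^T\bm{v}\\ \sigma\Delta\bm{W}^T\bm{v}\end{bmatrix},$$ and output $\sigma\bm{v}-[\Delta\bm{G}\ \ \sigma\Delta\bm{W}]\,\bm{p}$. These outputs are assumed to be well defined whenever they are used; the only property of them assumed in the corollary is the identity in hypothesis (2). *)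

(* Defs.v *)
From HB Require Import structures.
From mathcomp Require Import all_boot all_order all_algebra.
From mathcomp Require Import all_classical all_reals all_analysis.

Set Implicit Arguments.
Unset Strict Implicit.
Unset Printing Implicit Defensive.

Import Order.TTheory GRing.Theory Num.Theory.
Import numFieldNormedType.Exports.
Local Open Scope classical_set_scope.
Local Open Scope ring_scope.

Definition dot (R : realType) (d : nat) (u v : 'cV[R]_d) : R :=
  (u^T *m v) 0 0.

(* The library norm `|u| of a matrix is the sup norm, hence this definition;
   both induce the same topology. *)
Definition l2norm (R : realType) (d : nat) (u : 'cV[R]_d) : R :=
  Num.sqrt (dot u u).

(* Meaningful where f is differentiable. *)
Definition grad (R : realType) (d : nat) (f : 'cV[R]_d -> R) (w : 'cV[R]_d) :
    'cV[R]_d :=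
  \col_j 'D_(delta_mx j 0) f w.

(* Clients are indexed from 0, so clients 1, ..., m are those with index < m.
   Datasets are finite lists and the joint dataset is their concatenation, so
   that its size is the sum of the local sizes. *)
Definition joint_dataset (X : Type) (n m : nat) (D : 'I_n -> seq X) : seq X :=
  flatten [seq D i | i : 'I_n <- enum 'I_n & (m <= i)%N].

Lemma size_joint_dataset (X : Type) (n m : nat) (D : 'I_n -> seq X) :
  size (joint_dataset m D) = (\sum_(i < n | m <= i) size (D i))%N.
Proof.
by rewrite size_flatten sumnE /shape -map_comp big_map big_filter big_enum_cond.
Qed.

Definition fedavg (R : realType) (d : nat) (X : Type) (n m : nat)
    (D : 'I_n -> seq X) (x : 'I_n -> 'cV[R]_d) : 'cV[R]_d :=
  \sum_(i < n | (m <= i)%N)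
    ((size (D i))%:R / (size (joint_dataset m D))%:R) *: x i.

Fixpoint train_from_scratch (R : realType) (d : nat) (X : Type) (n m : nat)
    (D : 'I_n -> seq X) (loss : 'I_n -> 'cV[R]_d -> R) (eta : R)
    (w0 : 'cV[R]_d) (t : nat) : 'cV[R]_d :=
  if t is t'.+1 then
    let w := train_from_scratch m D loss eta w0 t' in
    w - eta *: fedavg m D (fun i => grad (loss i) w)
  else w0.

(* horizon = None encodes T = oo. *)
Record schedule := Schedule {
  horizon : option nat;
  warmup : nat;
  period : nat;
  tuning : nat }.

Definition in_run (sch : schedule) (t : nat) : bool :=
  if horizon sch is Some T then (t < T)%N else true.

(* The models indexed 0, ..., T exist: round t < T produces model t + 1. *)
Definition has_model (sch : schedule) (t : nat) : bool :=
  if horizon sch is Some T then (t <= T)%N else true.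

(* The truncated t - warmup is only relevant when warmup <= t, and the
   truncation of T - tuning at 0 does not affect the comparison with t. *)
Definition exact_round (sch : schedule) (t : nat) : bool :=
  [|| (t < warmup sch)%N,
      ((t - warmup sch + 1) %% period sch == 0)%N
    | if horizon sch is Some T then (T - tuning sch <= t)%N else false].

Definition estimated_round (sch : schedule) (t : nat) : bool :=
  in_run sch t && ~~ exact_round sch t.

(* The s most recent exact rounds before t, in increasing order. *)
Definition buffer (sch : schedule) (s t : nat) : seq nat :=
  let e := [seq b <- iota 0 t | exact_round sch b] in drop (size e - s) e.

Definition cols_mx (R : realType) (d s : nat) (x : nat -> 'cV[R]_d) :
    'M[R]_(d, s) :=
  \matrix_(j < d, k < s) x k j 0.

(* In the L-BFGS definitions below, dw k and dg k for 0 <= k < s stand for the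
   buffered differences at b_{k+1}; thus b_{s-1} corresponds to k = s - 2,
   which requires s >= 2.

   diag tells whether the lower triangular matrix of A includes the diagonal
   of A (as with the numerical routine tril) or is strict (as in the compact
   representation of Byrd, Nocedal and Schnabel). *)
Definition lbfgs_sigma (R : realType) (d s : nat) (dw dg : nat -> 'cV[R]_d) :
    R :=
  dot (dg s.-2) (dw s.-2) / dot (dw s.-2) (dw s.-2).

Definition lbfgs_mx (R : realType) (d : nat) (diag : bool) (s : nat)
    (dw dg : nat -> 'cV[R]_d) : 'M[R]_(s + s) :=
  let W := cols_mx s dw in
  let G := cols_mx s dg in
  let A := W^T *m G in
  let D := \matrix_(i, j) (if i == j then A i j else 0) in
  let L := \matrix_(i, j)
    (if (j < i)%N || (diag && (i == j)) then A i j else 0) in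
  block_mx (- D) L^T L (lbfgs_sigma s dw dg *: (W^T *m W)).

Definition lbfgs (R : realType) (d : nat) (diag : bool) (s : nat)
    (dw dg : nat -> 'cV[R]_d) (v : 'cV[R]_d) : 'cV[R]_d :=
  let W := cols_mx s dw in
  let G := cols_mx s dg in
  let sigma := lbfgs_sigma s dw dg in
  let p := invmx (lbfgs_mx diag s dw dg) *m
    col_mx (G^T *m v) (sigma *: (W^T *m v)) in
  sigma *: v - row_mx G (sigma *: W) *m p.

Definition lbfgs_defined (R : realType) (d : nat) (diag : bool) (s : nat)
    (dw dg : nat -> 'cV[R]_d) : Prop :=
  [/\ (2 <= s)%N, dot (dw s.-2) (dw s.-2) != 0
    & lbfgs_mx diag s dw dg \in unitmx].

(* wbar and gbar are the stored models and the stored updates of one client,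
   f is the loss of this client and what is the sequence of recovered models;
   only the models what 0, ..., what t are used. *)
Definition buffered_dw (R : realType) (d : nat) (sch : schedule) (s : nat)
    (wbar what : nat -> 'cV[R]_d) (t k : nat) : 'cV[R]_d :=
  let b := nth 0%N (buffer sch s t) k in what b - wbar b.

Definition buffered_dg (R : realType) (d : nat) (sch : schedule) (s : nat)
    (f : 'cV[R]_d -> R) (gbar what : nat -> 'cV[R]_d) (t k : nat) :
    'cV[R]_d :=
  let b := nth 0%N (buffer sch s t) k in grad f (what b) - gbar b.

Definition hvp (R : realType) (d : nat) (diag : bool) (sch : schedule) (s : nat)
    (f : 'cV[R]_d -> R) (wbar gbar what : nat -> 'cV[R]_d) (t : nat) :
    'cV[R]_d :=
  lbfgs diag s (buffered_dw sch s wbar what t) (buffered_dg sch s f gbar what t)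
    (what t - wbar t).

Definition hvp_defined (R : realType) (d : nat) (diag : bool) (sch : schedule)
    (s : nat) (f : 'cV[R]_d -> R) (wbar gbar what : nat -> 'cV[R]_d)
    (t : nat) : Prop :=
  lbfgs_defined diag s (buffered_dw sch s wbar what t)
    (buffered_dg sch s f gbar what t).

(* The recurrence determines what t for every t with has_model sch t. *)
Definition fedrecover (R : realType) (d : nat) (X : Type) (n m : nat)
    (D : 'I_n -> seq X) (loss : 'I_n -> 'cV[R]_d -> R) (eta : R)
    (diag : bool) (sch : schedule) (s : nat)
    (wbar : nat -> 'cV[R]_d) (gbar : 'I_n -> nat -> 'cV[R]_d)
    (what : nat -> 'cV[R]_d) : Prop :=
  what 0%N = wbar 0%N /\
  forall t, in_run sch t ->
    what t.+1 = what t - eta *: fedavg m D (fun i =>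
      if exact_round sch t then grad (loss i) (what t)
      else hvp diag sch s (loss i) wbar (gbar i) what t + gbar i t).

(* Main.v *)
(* When the Hessian-vector products are exact, every round of FedRecover is a
   gradient step on the averaged loss, just as in train-from-scratch. Averaging
   the steps of the clients by Jensen's inequality for the squared norm, such a
   step contracts l2 distances by sqrt (1 - eta mu): expanding the square of
   x - eta y, half of the cross term - 2 eta <x, y> absorbs eta^2 |y|^2 by
   cocoercivity since eta <= 1/L, and the other half yields the factor
   1 - eta mu by strong monotonicity. Train-from-scratch is then a Cauchy
   sequence, and FedRecover shares its limit. *)
Require Import Defs.
From HB Require Import structures.
From mathcomp Require Import all_boot all_order all_algebra.
From mathcomp Require Import all_classical all_reals all_analysis.
From mathcomp Require Import ring lra.

Set Implicit Arguments.
Unset Strict Implicit.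
Unset Printing Implicit Defensive.

Import Order.TTheory GRing.Theory Num.Theory.
Import numFieldNormedType.Exports.
Local Open Scope classical_set_scope.
Local Open Scope ring_scope.

Lemma dotE (R : realType) (d : nat) (u v : 'cV[R]_d) :
  dot u v = \sum_i u i 0 * v i 0.
Proof. by rewrite /dot mxE; apply: eq_bigr => i _; rewrite mxE. Qed.

Lemma dot_ge0 (R : realType) (d : nat) (u : 'cV[R]_d) : 0 <= dot u u.
Proof. by rewrite dotE sumr_ge0 // => i _; rewrite -expr2 sqr_ge0. Qed.

Lemma sqr_l2norm (R : realType) (d : nat) (u : 'cV[R]_d) :
  l2norm u ^+ 2 = dot u u.
Proof. exact/sqr_sqrtr/dot_ge0. Qed.

(** Limits are taken in the sup norm, whereas the contraction is in the l2 norm; this comparison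
    carries bounds from one to the other. *)
Lemma mx_norm_le_l2norm (R : realType) (d : nat) (u : 'cV[R]_d) :
  `|u| <= l2norm u.
Proof.
have [u0|/mx_norm_neq0[[i j] /= uE]] := eqVneq (mx_norm u) 0.
  by rewrite [`|u|]u0 sqrtr_ge0.
rewrite [`|u|]uE (ord1 j) -sqrtr_sqr ler_wsqrtr // dotE (bigD1 i) //= -expr2.
by rewrite lerDl sumr_ge0 // => k _; rewrite -expr2 sqr_ge0.
Qed.

Lemma dot_subZ (R : realType) (d : nat) (eta : R) (u v : 'cV[R]_d) :
  dot (u - eta *: v) (u - eta *: v)
    = dot u u - eta * dot u v *+ 2 + eta ^+ 2 * dot v v.
Proof.
rewrite !dotE !mulr_sumr -sumrMnl -sumrB -big_split /=.
by apply: eq_bigr => i _; rewrite !mxE; ring.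
Qed.

(** The weighted variance of [x] around its mean [c] is nonnegative; expanding it gives the
    claim. *)
Lemma sqr_convex_sum (R : realType) (I : finType) (P : pred I) (a x : I -> R) :
  (forall i, 0 <= a i) -> \sum_(i | P i) a i = 1 ->
  (\sum_(i | P i) a i * x i) ^+ 2 <= \sum_(i | P i) a i * x i ^+ 2.
Proof.
move=> a_ge0 sum_a; set c := \sum_(i | P i) a i * x i.
have : 0 <= \sum_(i | P i) a i * (x i - c) ^+ 2.
  by apply: sumr_ge0 => i _; rewrite mulr_ge0 ?sqr_ge0.
have -> : \sum_(i | P i) a i * (x i - c) ^+ 2
    = \sum_(i | P i) (a i * x i ^+ 2 - c *+ 2 * (a i * x i) + a i * c ^+ 2).
  by apply: eq_bigr => i _; ring.
rewrite big_split sumrB /= -mulr_sumr -mulr_suml sum_a mul1r -/c.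
lra.
Qed.

Lemma dot_convex_sum (R : realType) (d : nat) (I : finType) (P : pred I)
    (a : I -> R) (u : I -> 'cV[R]_d) :
  (forall i, 0 <= a i) -> \sum_(i | P i) a i = 1 ->
  dot (\sum_(i | P i) a i *: u i) (\sum_(i | P i) a i *: u i)
    <= \sum_(i | P i) a i * dot (u i) (u i).
Proof.
move=> a_ge0 sum_a; rewrite dotE.
under [leRHS]eq_bigr do rewrite dotE mulr_sumr.
rewrite [leRHS]exchange_big /=; apply: ler_sum => j _.
rewrite -expr2 summxE.
under [X in X ^+ 2 <= _]eq_bigr do rewrite mxE.
under [leRHS]eq_bigr do rewrite -expr2.
exact: sqr_convex_sum.
Qed.

(** Here [x] stands for the difference of two models and [y] for the difference of the gradients of
    one client there. *)
Lemma gradient_step_contracts (R : realType) (d : nat) (mu L eta : R)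
    (x y : 'cV[R]_d) :
  0 < eta -> eta <= L^-1 ->
  mu * l2norm x ^+ 2 <= dot x y -> L^-1 * l2norm y ^+ 2 <= dot x y ->
  dot (x - eta *: y) (x - eta *: y) <= (1 - eta * mu) * dot x x.
Proof.
rewrite !sqr_l2norm dot_subZ => eta_gt0 eta_le strong coco.
have yy : eta * dot y y <= dot x y.
  by apply: le_trans coco; rewrite ler_wpM2r // dot_ge0.
have := ler_wpM2l (ltW eta_gt0) yy; have := ler_wpM2l (ltW eta_gt0) strong.
by rewrite !mulrA -expr2 mulr2n; lra.
Qed.

(** The map iterated by [train_from_scratch], to which its successor case is convertible. *)
Definition fedavg_step (R : realType) (d : nat) (X : Type) (n m : nat)
    (D : 'I_n -> seq X) (loss : 'I_n -> 'cV[R]_d -> R) (eta : R)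
    (w : 'cV[R]_d) : 'cV[R]_d :=
  w - eta *: fedavg m D (fun i => grad (loss i) w).

Lemma fedavg_weights_sum (R : realType) (X : Type) (n m : nat)
    (D : 'I_n -> seq X) :
  (m < n)%N -> (forall i, (0 < size (D i))%N) ->
  \sum_(i < n | (m <= i)%N)
    ((size (D i))%:R / (size (joint_dataset m D))%:R : R) = 1.
Proof.
move=> lt_m_n D_gt0; rewrite -mulr_suml -natr_sum -size_joint_dataset divff //.
(* The client of index [m] remains, and its dataset is nonempty, so the joint size is nonzero. *)
rewrite pnatr_eq0 -lt0n size_joint_dataset (bigD1 (Ordinal lt_m_n)) //=.
by rewrite addn_gt0 D_gt0.
Qed.

Lemma fedavg_step_contracts (R : realType) (d n m : nat) (X : Type)
    (D : 'I_n -> seq X) (loss : 'I_n -> 'cV[R]_d -> R) (mu L eta : R)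
    (w w' : 'cV[R]_d) :
  (m < n)%N -> (forall i, (0 < size (D i))%N) ->
  0 < mu -> 0 < eta -> eta <= Num.min mu^-1 L^-1 ->
  (forall i, mu * l2norm (w - w') ^+ 2
    <= dot (w - w') (grad (loss i) w - grad (loss i) w')) ->
  (forall i, L^-1 * l2norm (grad (loss i) w - grad (loss i) w') ^+ 2
    <= dot (w - w') (grad (loss i) w - grad (loss i) w')) ->
  l2norm (fedavg_step m D loss eta w - fedavg_step m D loss eta w')
    <= Num.sqrt (1 - eta * mu) * l2norm (w - w').
Proof.
move=> lt_m_n D_gt0 mu_gt0 eta_gt0; rewrite le_min => /andP[eta_mu eta_L].
move=> strong coco.
pose a i : R := (size (D i))%:R / (size (joint_dataset m D))%:R.
have a_ge0 i : 0 <= a i by rewrite divr_ge0.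
have sum_a : \sum_(i < n | (m <= i)%N) a i = 1 by exact: fedavg_weights_sum.
have stepE v : fedavg_step m D loss eta v
    = v - eta *: \sum_(i < n | (m <= i)%N) a i *: grad (loss i) v by [].
(* From here on, the weights matter only through [a_ge0] and [sum_a]. The bound [eta <= mu^-1] keeps
   the factor nonnegative, so that its square root can be merged with the norm. *)
clearbody a; have le_etamu : 0 <= 1 - eta * mu.
  by rewrite subr_ge0 -ler_pdivlMr // div1r.
rewrite /l2norm -sqrtrM // ler_wsqrtr //.
(* As the weights sum to 1, [w - w'] is its own average, and the averaged step becomes an average of
   client steps. *)
have -> : fedavg_step m D loss eta w - fedavg_step m D loss eta w'
    = \sum_(i < n | (m <= i)%N)
        a i *: ((w - w') - eta *: (grad (loss i) w - grad (loss i) w')).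
  under eq_bigr do rewrite scalerBr scalerA mulrC -scalerA.
  rewrite sumrB -scaler_suml sum_a scale1r -scaler_sumr.
  under eq_bigr do rewrite scalerBr.
  rewrite sumrB scalerBr !stepE.
  by rewrite !opprD !opprK addrACA.
apply: le_trans (dot_convex_sum _ a_ge0 sum_a) _.
rewrite -[leRHS]mul1r -{1}sum_a mulr_suml; apply: ler_sum => i _.
by rewrite ler_wpM2l // (gradient_step_contracts (L := L)).
Qed.

(** Up to the constant [u 0], the sequence is the series of its increments, whose Cauchy blocks are
    dominated by those of a convergent geometric series. *)
Lemma geometric_steps_cvg (R : realType) (d : nat) (C q : R)
    (u : nat -> 'cV[R]_d) :
  0 <= q < 1 -> (forall n, `|u n.+1 - u n| <= C * q ^+ n) -> cvg (u @ \oo).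
Proof.
move=> /andP[q_ge0 q_lt1] u_steps.
have /cauchy_cvgP/cauchy_seriesP geo : cvgn (series (geometric C q)).
  by apply: is_cvg_geometric_series; rewrite ger0_norm.
have uE : u = series (telescope u) + cst (u 0%N).
  by rewrite telescopeK; apply/funext => n /=; rewrite subrK.
rewrite uE; apply: is_cvgD; last exact: is_cvg_cst.
apply/cauchy_cvgP/cauchy_seriesP => e e_gt0.
apply: filterS (geo _ e_gt0) => n /=.
apply: le_lt_trans; apply: le_trans (ler_norm _).
apply: le_trans (ler_norm_sum _ _ _) _; apply: ler_sum => k _.
exact: u_steps.
Qed.

Theorem corollary1 (R : realType) (d n m : nat) (X : Type)
  (D : 'I_n -> seq X) (loss : 'I_n -> 'cV[R]_d -> R) (mu L eta : R)
  (diag : bool) (sch : schedule) (s : nat)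
  (wbar : nat -> 'cV[R]_d) (gbar : 'I_n -> nat -> 'cV[R]_d)
  (what : nat -> 'cV[R]_d) (w0 : 'cV[R]_d)
  (lt_m_n : (m < n)%N)
  (D_nonempty : forall i, (0 < size (D i))%N)
  (loss_diff : forall i (w : 'cV[R]_d), differentiable (loss i) w)
  (mu_gt0 : 0 < mu) (L_gt0 : 0 < L)
  (strong_mono : forall i (w w' : 'cV[R]_d),
    mu * l2norm (w - w') ^+ 2
      <= dot (w - w') (grad (loss i) w - grad (loss i) w'))
  (cocoercive : forall i (w w' : 'cV[R]_d),
    L^-1 * l2norm (grad (loss i) w - grad (loss i) w') ^+ 2
      <= dot (w - w') (grad (loss i) w - grad (loss i) w'))
  (eta_gt0 : 0 < eta) (eta_le : eta <= Num.min mu^-1 L^-1)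
  (period_gt0 : (0 < period sch)%N) (lt_s_warmup : (s < warmup sch)%N)
  (gbar_benign : forall (i : 'I_n) t, (m <= i)%N -> in_run sch t ->
    gbar i t = grad (loss i) (wbar t))
  (what_fedrecover : fedrecover m D loss eta diag sch s wbar gbar what)
  (hvp_wd : forall (i : 'I_n) t, (m <= i)%N -> estimated_round sch t ->
    hvp_defined diag sch s (loss i) wbar (gbar i) what t)
  (hvp_exact : forall (i : 'I_n) t, (m <= i)%N -> estimated_round sch t ->
    hvp diag sch s (loss i) wbar (gbar i) what t + gbar i t
      = grad (loss i) (what t)) :
  let w := train_from_scratch m D loss eta w0 in
  (forall t, (0 < t)%N -> has_model sch t ->
    l2norm (what t - w t)
      <= Num.sqrt (1 - eta * mu) ^+ t * l2norm (what 0%N - w 0%N)) /\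
  (horizon sch = None ->
    [/\ cvg (what @ \oo), cvg (w @ \oo)
      & lim (what @ \oo) = lim (w @ \oo)]).
Proof.
set q := Num.sqrt (1 - eta * mu) => w.
have contr x y : l2norm (fedavg_step m D loss eta x
    - fedavg_step m D loss eta y) <= q * l2norm (x - y).
  exact: (fedavg_step_contracts (L := L)).
have what_step t : in_run sch t ->
    what t.+1 = fedavg_step m D loss eta (what t).
  move=> run_t; rewrite what_fedrecover.2 // /fedavg_step; congr (_ - _ *: _).
  (* Exact rounds agree by definition; estimated ones agree by [hvp_exact], client by client. *)
  apply: eq_bigr => i le_m_i; case: ifPn => // inexact.
  by rewrite hvp_exact // /estimated_round run_t.
have bound t : has_model sch t ->
    l2norm (what t - w t) <= q ^+ t * l2norm (what 0%N - w 0%N).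
  elim: t => [|t IHt] model_t; first by rewrite mul1r.
  (* Model [t.+1] exists exactly when round [t] is run, and then model [t] exists too. *)
  have run_t : in_run sch t.
    by move: model_t; rewrite /has_model /in_run; case: (horizon sch).
  rewrite what_step // exprS -mulrA (le_trans (contr _ _)) // ler_wpM2l //.
    exact: sqrtr_ge0.
  apply: IHt; move: run_t; rewrite /has_model /in_run.
  by case: (horizon sch) => // T /ltnW.
split=> [t _|hor]; first exact: bound.
have q01 : 0 <= q < 1.
  by rewrite sqrtr_ge0 -[ltRHS]sqrtr1 ltr_sqrt // gtrBl mulr_gt0.
(* Consecutive models are the images of the preceding pair under the same contraction, so the
   increments decay geometrically. *)
have w_steps t : l2norm (w t.+1 - w t) <= l2norm (w 1%N - w 0%N) * q ^+ t.
  elim: t => [|t IHt]; first by rewrite mulr1.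
  rewrite exprS mulrCA (le_trans (contr _ _)) // ler_wpM2l //.
  exact: sqrtr_ge0.
have w_cvg : cvg (w @ \oo).
  apply: geometric_steps_cvg q01 _ => t.
  exact: le_trans (mx_norm_le_l2norm _) (w_steps t).
(* With an infinite horizon, [bound] holds at every [t] and squeezes the difference below a
   geometric sequence of ratio [q < 1]. *)
have diff0 : (what - w) @ \oo --> (0 : 'cV[R]_d).
  apply/norm_cvg0P.
  have geo : geometric (l2norm (what 0%N - w 0%N)) q @ \oo --> (0 : R).
    by apply: cvg_geometric; case/andP: q01 => q0 q1; rewrite ger0_norm.
  apply: squeeze_cvgr (@cvg_cst _ _ _ _ _) geo; apply: nearW => t /=.
  rewrite normr_ge0 /= (le_trans (mx_norm_le_l2norm _)) // mulrC bound //.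
  by rewrite /has_model hor.
have what_lim : what @ \oo --> lim (w @ \oo).
  exact: cvg_sub0 diff0 w_cvg.
split=> //; first exact: cvgP what_lim.
exact: (cvg_lim (@norm_hausdorff _ _)).
Qed.
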